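(* Let $I\subseteq\mathbb{R}$ be a finite or infinite interval, $w$ a weight function on $I$, and $\{P_n\}_{n\ge0}$ the normalized orthogonal polynomials in $L^2_w(I)$. Let $\bar A_{\tau,\sigma}$, $\bar B_\tau$, $B_\tau$, $C_\tau$ ($\tau,\sigma\in I$) be the coefficients of a continuous-stage Runge-Kutta-Nyström method. Suppose that $C_\tau=\tau$ and that the function $(\tau,\sigma)\mapsto\bar A_{\tau,\sigma}/B_\sigma$ is in $L^2_w(I\times I)$. Then the symplectic condition $$\bar B_\tau=B_\tau(1-C_\tau),\ \tau\in I,\qquad B_\tau(\bar B_\sigma-\bar A_{\tau,\sigma})=B_\sigma(\bar B_\tau-\bar A_{\sigma,\tau}),\ \tau,\sigma\in I,$$ is equivalent to the fact that $\bar B_\tau$ and $\bar A_{\tau,\sigma}$ have the form $$\bar B_\tau=B_\tau(1-\tau),\quad\tau\in I,$$ $$\bar A_{\tau,\sigma}=B_\sigma\Big(\alpha_{(0,0)}+\alpha_{(0,1)}P_1(\sigma)+\alpha_{(1,0)}P_1(\tau)+\sum_{i+j>1}\alpha_{(i,j)}P_i(\tau)P_j(\sigma)\Big),\quad\tau,\sigma\in I,$$ where $\alpha_{(0,0)}$ is an arbitrary real number, $\alpha_{(0,1)}-\alpha_{(1,0)}=-\langle x,P_1(x)\rangle_w$, and the real parameters $\alpha_{(i,j)}$ are symmetric, i.e. $\alpha_{(i,j)}=\alpha_{(j,i)}$ for all $i+j>1$.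
   Context: A non-negative function $w$ on $I$ is a weight function if all moments $\int_I x^kw(x)\,dx$, $k\in\mathbb{N}$, exist, and for any non-negative function $u$, $\int_I u w\,dx=0$ implies $u\equiv0$. $L^2_w(I)$ is the Hilbert space with inner product $\langle u,v\rangle_w=\int_Iu(x)v(x)w(x)\,dx$; $L^2_w(I\times I)$ is the corresponding space of two-variable functions with weight $w(\tau)w(\sigma)$. $\{P_n\}_{n\ge0}$ are the orthogonal polynomials ($\deg P_n=n$) with $\langle P_i,P_j\rangle_w=\delta_{ij}$, assumed to be a complete set in $L^2_w(I)$. The indices $i,j$ range over non-negative integers and the series is the expansion in $L^2_w(I\times I)$ with respect to the basis $\{P_i(\tau)P_j(\sigma)\}$. Writing the quotient $\bar A_{\tau,\sigma}/B_\sigma$ presupposes that it is defined. A continuous-stage Runge-Kutta-Nyström method for $q''=f(q)=-M\nabla V(q)$ ($M$ a constant symmetric matrix, $V$ a scalar function, $q'=Mp$), with $g(q)=-\nabla V(q)$ and step size $h$, is $$Q_\tau=q_0+hC_\tau Mp_0+h^2\int_I\bar A_{\tau,\sigma}w(\sigma)f(Q_\sigma)\,d\sigma,\ \tau\in I,$$ $$q_1=q_0+hMp_0+h^2\int_I\bar B_\tau w(\tau)f(Q_\tau)\,d\tau,\qquad p_1=p_0+h\int_IB_\tau w(\tau)g(Q_\tau)\,d\tau.$$ *)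

(* Defs.v *)
From HB Require Import structures.
From mathcomp Require Import all_boot all_order all_algebra.
From mathcomp Require Import all_classical all_reals all_analysis.
Import Order.TTheory GRing.Theory Num.Theory.
Import numFieldNormedType.Exports.

Set Implicit Arguments.
Unset Strict Implicit.
Unset Printing Implicit Defensive.

Local Open Scope classical_set_scope.
Local Open Scope ring_scope.

Local Notation leb R := (@lebesgue_measure R).

Local Notation leb2 R := (@lebesgue_measure R \x @lebesgue_measure R)%E.

Definition square_set (R : realType) (I : interval R) : set (R * R) :=
  [set` I] `*` [set` I].

(* As everywhere for L^2, a function vanishing almost everywhere counts as the
   zero function; with a pointwise reading no weight function would exist. *)
Definition is_weight (R : realType) (I : interval R) (w : R -> R) : Prop :=
  [/\ forall x, x \in I -> 0 <= w x,
      forall k : nat,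
        (leb R).-integrable [set` I] (fun x => (x ^+ k * w x)%:E)
    & forall u : R -> R,
        measurable_fun [set` I] u ->
        (forall x, x \in I -> 0 <= u x) ->
        (\int[leb R]_(x in [set` I]) (u x * w x)%:E = 0)%E ->
        {ae leb R, forall x, x \in I -> u x = 0}].

Definition inL2 (R : realType) (I : interval R) (w u : R -> R) : Prop :=
  measurable_fun [set` I] u /\
  (leb R).-integrable [set` I] (fun x => (u x ^+ 2 * w x)%:E).

Definition ip (R : realType) (I : interval R) (w u v : R -> R) : R :=
  \int[leb R]_(x in [set` I]) (u x * v x * w x).

Definition normL2 (R : realType) (I : interval R) (w u : R -> R) : R :=
  Num.sqrt (ip I w u u).

Definition inL2_2 (R : realType) (I : interval R) (w : R -> R)
    (F : R * R -> R) : Prop :=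
  measurable_fun (square_set I) F /\
  (leb2 R).-integrable (square_set I)
    (fun z => (F z ^+ 2 * (w z.1 * w z.2))%:E).

Definition ip2 (R : realType) (I : interval R) (w : R -> R)
    (F G : R * R -> R) : R :=
  \int[leb2 R]_(z in square_set I) (F z * G z * (w z.1 * w z.2)).

Definition normL2_2 (R : realType) (I : interval R) (w : R -> R)
    (F : R * R -> R) : R :=
  Num.sqrt (ip2 I w F F).

Definition orthonormal_polys (R : realType) (I : interval R) (w : R -> R)
    (P : nat -> {poly R}) : Prop :=
  (forall n, size (P n) = n.+1) /\
  (forall i j, ip I w (fun x => (P i).[x]) (fun x => (P j).[x]) = (i == j)%:R).

Definition complete_in_L2 (R : realType) (I : interval R) (w : R -> R)
    (P : nat -> {poly R}) : Prop :=
  forall u : R -> R, inL2 I w u ->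
  forall e : R, 0 < e ->
  exists (n : nat) (c : nat -> R),
    normL2 I w (fun x => u x - \sum_(i < n) c i * (P i).[x]) < e.

(* The coefficient functions are only used at points of I. *)
Record csRKN_coeffs (R : realType) := CsRKN {
  cs_Abar : R -> R -> R;
  cs_Bbar : R -> R;
  cs_B : R -> R;
  cs_C : R -> R
}.

(* The identity in two variables is taken for almost every (tau, sigma): it is
   compared with an L^2 expansion, which determines functions only a.e. *)
Definition symplectic_condition (R : realType) (I : interval R)
    (m : csRKN_coeffs R) : Prop :=
  (forall tau, tau \in I -> cs_Bbar m tau = cs_B m tau * (1 - cs_C m tau)) /\
  {ae leb2 R, forall z : R * R, z.1 \in I -> z.2 \in I ->
    cs_B m z.1 * (cs_Bbar m z.2 - cs_Abar m z.1 z.2) =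
    cs_B m z.2 * (cs_Bbar m z.1 - cs_Abar m z.2 z.1)}.

Definition expansion_partial (R : realType) (P : nat -> {poly R})
    (alpha : nat -> nat -> R) (n : nat) (z : R * R) : R :=
  alpha 0%N 0%N + alpha 0%N 1%N * (P 1%N).[z.2] + alpha 1%N 0%N * (P 1%N).[z.1]
  + \sum_(i < n) \sum_(j < n | (1 < i + j)%N)
      alpha i j * ((P i).[z.1] * (P j).[z.2]).

Definition expansion_sum (R : realType) (I : interval R) (w : R -> R)
    (P : nat -> {poly R}) (alpha : nat -> nat -> R) (S : R * R -> R) : Prop :=
  inL2_2 I w S /\
  normL2_2 I w (fun z => S z - expansion_partial P alpha n z)
    @[n --> \oo] --> (0 : R).

Definition has_expansion_form (R : realType) (I : interval R) (w : R -> R)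
    (P : nat -> {poly R}) (m : csRKN_coeffs R) : Prop :=
  (forall tau, tau \in I -> cs_Bbar m tau = cs_B m tau * (1 - tau)) /\
  exists alpha : nat -> nat -> R,
    [/\ alpha 0%N 1%N - alpha 1%N 0%N =
          - ip I w (fun x => x) (fun x => (P 1%N).[x]),
        forall i j : nat, (1 < i + j)%N -> alpha i j = alpha j i
      & exists2 S : R * R -> R, expansion_sum I w P alpha S &
          {ae leb2 R, forall z : R * R, z.1 \in I -> z.2 \in I ->
            cs_Abar m z.1 z.2 = cs_B m z.2 * S z}].

(* Main.v *)
Require Import Defs.
From HB Require Import structures.
From mathcomp Require Import all_boot all_order all_algebra.
From mathcomp Require Import all_classical all_reals all_analysis.
From mathcomp Require Import measurable_realfun ring lra.
Import Order.TTheory GRing.Theory Num.Theory.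
Import numFieldNormedType.Exports.

Local Open Scope classical_set_scope.
Local Open Scope ring_scope.

(** Dividing the second symplectic identity by [B_tau * B_sigma] and inserting
    [Bbar_tau = B_tau * (1 - tau)] turns it into an identity for the single
    function [F(tau, sigma) = Abar_(tau, sigma) / B_sigma], namely
    [F(tau, sigma) - F(sigma, tau) = tau - sigma] ([antisym_kernelP]).  The
    theorem is the translation of this identity to the coefficients of [F] in
    the basis [P_i(tau) * P_j(sigma)].  The translation rests on
    [x = k + b * P_1(x)] with [b = <x, P_1>] ([id_affine_poly1]), which gives
    [tau - sigma = b * (P_1(tau) - P_1(sigma))]: only the indices (0, 1) and
    (1, 0) of the expansion can see the difference of [F] and its transpose.

    From the expansion to the identity ([antisym_of_expansion]), every partial
    sum [S_n] satisfies [S_n(tau, sigma) - S_n(sigma, tau) = tau - sigma]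
    exactly.  Since the two-variable norm is invariant under exchange, the
    squared norm of the defect of the sum [S] is at most [4 * |S - S_n|^2],
    which tends to 0; the weight being positive almost everywhere, the defect
    vanishes almost everywhere.

    From the identity to the expansion ([expansion_of_antisym]), the parameters
    are the Fourier coefficients of [F], rescaled by powers of the constant
    [P_0].  What has to be proved is that the products [P_i(tau) * P_j(sigma)]
    are complete as soon as the [P_i] are.  This is done by Parseval's identity
    rather than by approximating [F]: with [f_j(x)] the [j]-th coefficient of
    [F(x, .)], Parseval in the second variable and dominated convergence give
    [|F|^2 = sum_j |f_j|^2], and Parseval in the first variable expands each
    [|f_j|^2] ([parseval_tensor]).  The squared distance from [F] to its Fourier partial
    sum is then [|F|^2] minus a partial sum of this double series.

    The weight is removed at the start: multiplying by the square root of [w],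
    extended by 0 outside the interval, turns weighted inner products into
    unweighted ones on the whole line or plane ([ip_weigh], [ip2_weigh]), so
    that the Hilbert space part is carried out for a general sigma-finite
    measure. *)

(** * Square-integrable functions and Parseval's identity *)

Section SquareIntegrable.
Set Implicit Arguments.
Unset Strict Implicit.
Context {d : measure_display} {T : measurableType d} {R : realType}.
Variable mu : {measure set T -> \bar R}.
Implicit Types u v : T -> R.

Definition sqint u :=
  measurable_fun setT u /\ mu.-integrable setT (fun x => (u x ^+ 2)%:E).

Definition dot u v : R := \int[mu]_x (u x * v x).

(** [2 * |u * v| <= u ^ 2 + v ^ 2]: this makes [dot] an honest inner product on
    the square-integrable functions. *)
Lemma sqintM u v : sqint u -> sqint v ->
  mu.-integrable setT (fun x => (u x * v x)%:E).
Proof.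
move=> [mu_ iu] [mv iv].
apply: (@le_integrable _ _ _ mu setT measurableT _
  (fun x => ((u x ^+ 2)%:E + (v x ^+ 2)%:E)%E)).
- by apply/measurable_EFinP; exact: measurable_funM.
- move=> x _; rewrite -EFinD !abse_EFin lee_fin (ger0_norm (_ : 0 <= _ + _)).
    rewrite normrM -(real_normK (num_real (u x))).
    rewrite -(real_normK (num_real (v x))).
    have := sqr_ge0 (`|u x| - `|v x|); nra.
  by rewrite addr_ge0 ?sqr_ge0.
- exact: integrableD.
Qed.

Lemma sqint0 : sqint (fun=> 0).
Proof.
split; first exact: measurable_cst.
by under eq_fun do rewrite expr0n/=; exact: integrable0.
Qed.

Lemma sqintZ c u : sqint u -> sqint (fun x => c * u x).
Proof.
move=> [mu_ iu]; split; first exact: measurable_funM.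
under eq_fun do rewrite exprMn EFinM.
exact: integrableZl.
Qed.

Lemma sqintD u v : sqint u -> sqint v -> sqint (fun x => u x + v x).
Proof.
move=> su sv; split; first by apply: measurable_funD; [case: su|case: sv].
under eq_fun do rewrite sqrrD -mulr_natl -addrA EFinD EFinD.
apply: integrableD => //; first by case: su.
apply: integrableD => //; last by case: sv.
by under eq_fun do rewrite EFinM; apply: integrableZl => //; exact: sqintM.
Qed.

Lemma sqintN u : sqint u -> sqint (fun x => - u x).
Proof. by move=> /(sqintZ (-1)); under eq_fun do rewrite mulN1r. Qed.

Lemma sqintB u v : sqint u -> sqint v -> sqint (fun x => u x - v x).
Proof. by move=> su sv; apply: sqintD => //; exact: sqintN. Qed.

Lemma sqint_sum (J : Type) (s : seq J) (p : pred J) (f : J -> T -> R) :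
  (forall j, sqint (f j)) -> sqint (fun x => \sum_(j <- s | p j) f j x).
Proof.
move=> sf; elim: s => [|j s ih].
  by under eq_fun do rewrite big_nil; exact: sqint0.
under eq_fun do rewrite big_cons.
by case: (p j) => //; exact: sqintD.
Qed.

Lemma dotC u v : dot u v = dot v u.
Proof. by apply: eq_Rintegral => x _; rewrite mulrC. Qed.

Lemma dot_ge0 u : 0 <= dot u u.
Proof. by apply: Rintegral_ge0 => x _; rewrite -expr2 sqr_ge0. Qed.

Lemma EFin_dot u v : sqint u -> sqint v ->
  (dot u v)%:E = (\int[mu]_x (u x * v x)%:E)%E.
Proof.
by move=> su sv; rewrite fineK// integrable_fin_num//; exact: sqintM.
Qed.

Lemma dotDl u u' v : sqint u -> sqint u' -> sqint v ->
  dot (fun x => u x + u' x) v = dot u v + dot u' v.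
Proof.
move=> su su' sv; rewrite /dot; under eq_Rintegral do rewrite mulrDl.
by rewrite RintegralD//; exact: sqintM.
Qed.

Lemma dotZl c u v : sqint u -> sqint v ->
  dot (fun x => c * u x) v = c * dot u v.
Proof.
move=> su sv; rewrite /dot; under eq_Rintegral do rewrite -mulrA.
by rewrite RintegralZl//; exact: sqintM.
Qed.

Lemma dotBl u u' v : sqint u -> sqint u' -> sqint v ->
  dot (fun x => u x - u' x) v = dot u v - dot u' v.
Proof.
move=> su su' sv; rewrite dotDl//; last exact: sqintN.
by rewrite -[- dot u' v]mulN1r -dotZl//; congr (_ + _);
  apply: eq_Rintegral => x _; rewrite mulN1r.
Qed.

Lemma dot_suml (J : Type) (s : seq J) (f : J -> T -> R) v :
  (forall j, sqint (f j)) -> sqint v ->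
  dot (fun x => \sum_(j <- s) f j x) v = \sum_(j <- s) dot (f j) v.
Proof.
move=> sf sv; elim: s => [|j s ih].
  rewrite big_nil /dot; under eq_Rintegral do rewrite big_nil mul0r.
  by rewrite /Rintegral integral0.
rewrite big_cons -ih -dotDl//; last exact: sqint_sum.
by apply: eq_Rintegral => x _; rewrite big_cons.
Qed.

(** Completing the square: the coefficients [c j] enter only through their
    distance to the Fourier coefficients of [u], so this single identity gives
    both Bessel's inequality and the optimality of the Fourier partial sums. *)
Lemma dist_orthonormal (J : finType) (e : J -> T -> R) u (c : J -> R) :
  (forall j, sqint (e j)) -> (forall i j, dot (e i) (e j) = (i == j)%:R) ->
  sqint u ->
  dot (fun x => u x - \sum_j c j * e j x) (fun x => u x - \sum_j c j * e j x)
  = dot u u - \sum_j dot u (e j) ^+ 2 + \sum_j (c j - dot u (e j)) ^+ 2.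
Proof.
move=> se oe su.
have sce j : sqint (fun x => c j * e j x) by exact: sqintZ.
have ssum : sqint (fun x => \sum_j c j * e j x) by exact: sqint_sum.
have sB := sqintB su ssum.
have dotSl v : sqint v ->
    dot (fun x => \sum_j c j * e j x) v = \sum_j c j * dot (e j) v.
  by move=> sv; rewrite dot_suml//; apply: eq_bigr => j _; rewrite dotZl.
have Lu : dot (fun x => \sum_j c j * e j x) u = \sum_j c j * dot u (e j).
  by rewrite dotSl//; apply: eq_bigr => j _; rewrite dotC.
have LL : dot (fun x => \sum_j c j * e j x) (fun x => \sum_j c j * e j x) =
    \sum_j c j ^+ 2.
  rewrite dotSl//; apply: eq_bigr => j _; rewrite dotC dotSl// (bigD1 j)//=.
  rewrite oe eqxx mulr1 big1 ?addr0 ?expr2// => k kj.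
  by rewrite oe (negbTE kj) mulr0.
set S := fun x => \sum_j c j * e j x in ssum sB Lu LL *.
rewrite dotBl// (dotC u) (dotC S (fun=> _)) !dotBl// (dotC u S) Lu LL.
under [X in _ = _ + X]eq_bigr do rewrite sqrrB -mulr_natl.
rewrite big_split sumrB -mulr_sumr/=; ring.
Qed.

Section Parseval.
Variable e : nat -> T -> R.
Hypothesis se : forall i, sqint (e i).
Hypothesis oe : forall i j, dot (e i) (e j) = (i == j)%:R.

Lemma bessel1 u i : sqint u -> dot u (e i) ^+ 2 <= dot u u.
Proof.
move=> su.
have := @dist_orthonormal 'I_1 (fun=> e i) u (fun=> dot u (e i)) (fun=> se i).
rewrite !big_ord1 subrr expr0n addr0 => /(_ _ su) H.
rewrite -subr_ge0 -H ?dot_ge0// => j k.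
by rewrite oe eqxx !ord1.
Qed.

Lemma bessel u n : sqint u -> \sum_(i < n) dot u (e i) ^+ 2 <= dot u u.
Proof.
move=> su; pose c (i : 'I_n) := dot u (e i).
have := @dist_orthonormal 'I_n (fun i => e i) u c (fun i => se i).
rewrite [X in _ + X]big1 ?addr0; last by move=> i _; rewrite subrr expr0n.
move=> H; rewrite -subr_ge0 -H ?dot_ge0// => i j; exact: oe.
Qed.

(** Only [u] itself has to be approximable by the system: the Fourier partial
    sum of order [N] is at least as close to [u] as any other combination of the
    same length, and longer Fourier partial sums are closer still. *)
Lemma parseval u : sqint u ->
  (forall eps, 0 < eps -> exists (n : nat) (c : nat -> R),
    dot (fun x => u x - \sum_(i < n) c i * e i x)
        (fun x => u x - \sum_(i < n) c i * e i x) < eps) ->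
  (\sum_(i < n) dot u (e i) ^+ 2) @[n --> \oo] --> dot u u.
Proof.
move=> su cu; apply/cvgrPdist_lt => eps /cu [N [c]].
rewrite (@dist_orthonormal 'I_N (fun i => e i) u c)//.
move=> cN; near=> n.
rewrite ger0_norm ?subr_ge0 ?bessel//; apply: le_lt_trans cN.
rewrite -[leLHS]addr0 lerD//; last by apply: sumr_ge0 => i _; exact: sqr_ge0.
have Nn : (N <= n)%N by near: n; exact: nbhs_infty_ge.
rewrite lerD2l lerN2 -!(big_mkord xpredT (fun i => dot u (e i) ^+ 2)).
rewrite [leRHS](big_cat_nat (leq0n N) Nn)//= lerDl.
by apply: sumr_ge0 => i _; exact: sqr_ge0.
Unshelve. all: by end_near. Qed.

End Parseval.

End SquareIntegrable.

(** * Parseval's identity for a tensor product of orthonormal systems *)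

Section TensorProduct.
Set Implicit Arguments.
Unset Strict Implicit.
Context {d : measure_display} {T : measurableType d} {R : realType}.
Variable mu : {sigma_finite_measure set T -> \bar R}.
Local Notation mu2 := (mu \x mu)%E.
Implicit Types (f g a e : T -> R) (G : T * T -> R).

Definition tensor f g (z : T * T) : R := f z.1 * g z.2.

(** The coefficient of the fiber [G (x, -)] along [e]; for the exceptional [x]
    whose fiber is not square-integrable the value is an artefact of the total
    integral, but these [x] form a null set. *)
Definition fiber_dot G e (x : T) : R := dot mu (fun y => G (x, y)) e.

Lemma measurable_tensor f g : measurable_fun setT f -> measurable_fun setT g ->
  measurable_fun setT (tensor f g).
Proof.
by move=> mf mg; apply: measurable_funM; apply: measurableT_comp.
Qed.

Lemma integrable_tensor f g :
  mu.-integrable setT (EFin \o f) -> mu.-integrable setT (EFin \o g) ->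
  mu2.-integrable setT (EFin \o tensor f g).
Proof.
move=> fi gi.
have /measurable_EFinP mf := measurable_int mu fi.
have /measurable_EFinP mg := measurable_int mu gi.
apply/integrable12ltyP.
  by apply/measurable_EFinP; exact: measurable_tensor.
have [_ If] := integrableP _ _ _ fi; have [_ Ig] := integrableP _ _ _ gi.
under eq_integral => x _.
  under eq_integral do rewrite -[(EFin \o _) _]/((f x * g _)%:E) EFinM abseM.
  rewrite ge0_integralZl//; last first.
    by apply: measurableT_comp => //; exact/measurable_EFinP.
  over.
rewrite /= ge0_integralZr//; last 2 first.
- by do 2 apply: measurableT_comp => //.
- by apply: integral_ge0.
rewrite lte_mul_pinfty// ?integral_ge0//.
by rewrite ge0_fin_numE// integral_ge0.
Qed.

Lemma Rintegral_tensor f g :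
  mu.-integrable setT (EFin \o f) -> mu.-integrable setT (EFin \o g) ->
  \int[mu2]_z tensor f g z = (\int[mu]_x f x) * (\int[mu]_x g x).
Proof.
move=> fi gi; rewrite /Rintegral.
rewrite -(integral12_prod_meas1 (integrable_tensor fi gi)) /fubini_F.
rewrite -fineM ?integrable_fin_num//; congr fine.
transitivity (\int[mu]_x ((f x)%:E * \int[mu]_y (g y)%:E))%E.
  by apply: eq_integral => x _; rewrite -integralZl.
by rewrite -(fineK (integrable_fin_num _ gi))// integralZr.
Qed.

Lemma sqint_tensor f g : sqint mu f -> sqint mu g -> sqint mu2 (tensor f g).
Proof.
move=> [mf fi] [mg gi]; split; first exact: measurable_tensor.
under eq_fun do rewrite /tensor exprMn.
exact: (integrable_tensor fi gi).
Qed.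

Lemma dot_tensor f g f' g' : sqint mu f -> sqint mu g -> sqint mu f' ->
  sqint mu g' ->
  dot mu2 (tensor f g) (tensor f' g') = dot mu f f' * dot mu g g'.
Proof.
move=> sf sg sf' sg'.
rewrite -Rintegral_tensor; [|exact: sqintM..].
by apply: eq_Rintegral => z _; rewrite /tensor mulrACA.
Qed.

(** [G (x, y) * e y] need not be integrable on the product, so the measurability
    that comes with Fubini's theorem is not available; the positive and negative
    parts are handled separately by Tonelli's theorem. *)
Lemma measurable_fiber_dot G e : measurable_fun setT G ->
  measurable_fun setT e -> measurable_fun setT (fiber_dot G e).
Proof.
move=> mG me; pose H z := ((G z * e z.2)%:E).
have mH : measurable_fun setT H.
  apply/measurable_EFinP; apply: measurable_funM => //.
  exact: (measurableT_comp me measurable_snd).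
rewrite (_ : fiber_dot G e =
    fine \o (fun x => fubini_F mu H^\+ x - fubini_F mu H^\- x)%E); last first.
  apply/funext => x; rewrite /fiber_dot /dot /Rintegral integralE.
  by congr (fine (_ - _)); apply: eq_integral => y _;
    rewrite !(funeposE, funenegE).
apply: measurableT_comp => //; apply: emeasurable_funB.
  apply: measurable_fun_fubini_tonelli_F => //.
  exact: measurable_funepos.
apply: measurable_fun_fubini_tonelli_F => //.
exact: measurable_funeneg.
Qed.

Lemma ae_sqint_fiber G : sqint mu2 G ->
  {ae mu, forall x, sqint mu (fun y => G (x, y))}.
Proof.
move=> [mG iG]; have := ae_integrable1 iG.
apply: filterS => x ix; split => //.
exact: measurable_fun_pair2.
Qed.

Section Parseval2.
Variable e : nat -> T -> R.
Hypothesis se : forall i, sqint mu (e i).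
Hypothesis oe : forall i j, dot mu (e i) (e j) = (i == j)%:R.

Definition pair_coef G i j : R := dot mu2 G (tensor (e i) (e j)).

(** Bessel's inequality on almost every fiber bounds [fiber_dot G (e j) x ^ 2] by
    the squared norm of the fiber, whose integral is the squared norm of [G]. *)
Lemma sqint_fiber_dot G j : sqint mu2 G -> sqint mu (fiber_dot G (e j)).
Proof.
move=> sG; have [mG iG] := sG.
have mf : measurable_fun setT (fiber_dot G (e j)).
  by apply: measurable_fiber_dot => //; case: (se j).
split=> //; apply/integrableP; split.
  by apply/measurable_EFinP; exact: measurable_funX.
have /integrable_lty : mu.-integrable setT
    (fubini_F mu (fun z => (G z ^+ 2)%:E)).
  exact: integrable_fubini_F.
move/(_ measurableT); apply: le_lt_trans.
apply: ae_ge0_le_integral => //.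
- apply: measurableT_comp => //; apply/measurable_EFinP.
  exact: measurable_funX.
- by move=> x _; apply: integral_ge0 => y _; rewrite lee_fin sqr_ge0.
- apply: measurable_fun_fubini_tonelli_F; last first.
    by move=> z; rewrite lee_fin sqr_ge0.
  by apply/measurable_EFinP; exact: measurable_funX.
apply: filterS (ae_sqint_fiber sG) => x sx _.
rewrite gee0_abs ?lee_fin ?sqr_ge0//.
rewrite (_ : fubini_F mu _ x =
    (dot mu (fun y => G (x, y)) (fun y => G (x, y)))%:E).
  by rewrite lee_fin; exact: bessel1.
by rewrite EFin_dot//; apply: eq_integral => y _; rewrite expr2.
Qed.

(** The double coefficients of [G] are the coefficients of its fiber
    coefficients, by Fubini's theorem; this reduces two variables to one. *)
Lemma dot_fiber_dot G a j : sqint mu2 G -> sqint mu a ->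
  dot mu2 G (tensor a (e j)) = dot mu (fiber_dot G (e j)) a.
Proof.
move=> sG sa; rewrite /dot /Rintegral; congr fine.
have iG := sqintM sG (sqint_tensor sa (se j)).
rewrite -(integral12_prod_meas1 iG); apply: ae_eq_integral => //.
- exact: (measurable_fubini_F iG).
- apply/measurable_EFinP; apply: measurable_funM; last by case: sa.
  by case: (sqint_fiber_dot j sG).
apply: filterS (ae_sqint_fiber sG) => x sx _.
rewrite EFinM muleC EFin_dot// -integralZl//; last exact: sqintM.
by apply: eq_integral => y _; rewrite -EFinM/tensor/= mulrCA.
Qed.

Lemma dist_tensor G n (c : nat -> nat -> R) : sqint mu2 G ->
  let D z := G z - \sum_(i < n) \sum_(j < n) c i j * tensor (e i) (e j) z in
  dot mu2 D D = dot mu2 G G - \sum_(i < n) \sum_(j < n) pair_coef G i j ^+ 2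
    + \sum_(i < n) \sum_(j < n) (c i j - pair_coef G i j) ^+ 2.
Proof.
move=> sG /=; rewrite !pair_bigA /=.
under [X in dot _ X _]eq_fun do rewrite pair_bigA /=.
under [X in dot _ _ X]eq_fun do rewrite pair_bigA /=.
rewrite (@dist_orthonormal _ _ _ mu2 ('I_n * 'I_n)%type
  (fun p => tensor (e p.1) (e p.2)) G (fun p => c p.1 p.2))//.
- by move=> p; exact: sqint_tensor.
- move=> [i j] [k l]; rewrite dot_tensor// !oe -natrM mulnb; congr (_%:R).
Qed.

Lemma bessel_tensor G n : sqint mu2 G ->
  \sum_(i < n) \sum_(j < n) pair_coef G i j ^+ 2 <= dot mu2 G G.
Proof.
move=> sG; have /= := dist_tensor n (pair_coef G) sG.
rewrite [X in _ = _ + X](_ : _ = 0); last first.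
  by rewrite big1// => i _; rewrite big1// => j _; rewrite subrr expr0n.
by rewrite addr0 -subr_ge0 => <-; exact: dot_ge0.
Qed.

(* Completeness is only asked on a set [D], since a weighted system on an
   interval, once extended by zero, is complete only among the functions that
   vanish off the interval. *)
Variable D : set T.
Hypothesis ce : forall u, sqint mu u -> (forall x, ~ D x -> u x = 0) ->
  forall eps, 0 < eps -> exists (n : nat) (c : nat -> R),
    dot mu (fun x => u x - \sum_(i < n) c i * e i x)
           (fun x => u x - \sum_(i < n) c i * e i x) < eps.

(** Parseval's identity holds on almost every fiber, and the partial sums are
    dominated by the squared norm of the fiber, so that it can be integrated. *)
Lemma cvg_sum_fiber_dot G : sqint mu2 G ->
  (forall x y, ~ D y -> G (x, y) = 0) ->
  (\sum_(j < n) dot mu (fiber_dot G (e j)) (fiber_dot G (e j))) @[n --> \oo]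
    --> dot mu2 G G.
Proof.
move=> sG G0; have [mG iG] := sG.
pose f n x := (\sum_(j < n) fiber_dot G (e j) x ^+ 2)%:E.
pose g := fubini_F mu (fun z => (G z ^+ 2)%:E).
have ig : mu.-integrable setT g by exact: integrable_fubini_F.
have gE x : sqint mu (fun y => G (x, y)) ->
    g x = (dot mu (fun y => G (x, y)) (fun y => G (x, y)))%:E.
  by move=> sx; rewrite EFin_dot//; apply: eq_integral => y _; rewrite expr2.
have [|||||_ _] := @dominated_convergence _ _ _ mu setT measurableT f g g.
- move=> n; apply/measurable_EFinP; apply: measurable_sum => j.
  by apply: measurable_funX; case: (sqint_fiber_dot j sG).
- exact: measurable_int ig.
- apply: filterS (ae_sqint_fiber sG) => x sx _; rewrite gE//.
  apply: cvg_EFin; first exact: nearW.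
  by apply: parseval => //; apply: ce => //; exact: G0.
- exact: ig.
- apply: filterS (ae_sqint_fiber sG) => x sx n _; rewrite gE//.
  rewrite gee0_abs ?lee_fin; first exact: bessel.
  by apply: sumr_ge0 => j _; exact: sqr_ge0.
rewrite (integral12_prod_meas1 iG).
under eq_integral do rewrite expr2.
rewrite -EFin_dot// => H.
suff -> : (fun n => \sum_(j < n) dot mu (fiber_dot G (e j)) (fiber_dot G (e j)))
    = fine \o (fun n => \int[mu]_x f n x)%E by exact: fine_cvg H.
apply/funext => n /=; rewrite /f; under eq_integral do rewrite -sumEFin.
rewrite integral_sum//; last by move=> j; case: (sqint_fiber_dot j sG).
rewrite -[LHS]/(fine (_%:E)) -sumEFin; congr fine; apply: eq_bigr => j _.
rewrite EFin_dot; [|exact: sqint_fiber_dot..].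
by apply: eq_integral => x _; rewrite expr2.
Qed.

(** The square partial sums are bounded by the squared norm of [G]; for the lower
    bound a finite number [J] of columns is kept, enough to come close to
    that norm by [cvg_sum_fiber_dot], and in each of them the sum is expanded in
    the first variable. *)
Lemma parseval_tensor G : sqint mu2 G ->
  (forall x y, ~ D x \/ ~ D y -> G (x, y) = 0) ->
  (\sum_(i < n) \sum_(j < n) pair_coef G i j ^+ 2) @[n --> \oo] -->
    dot mu2 G G.
Proof.
move=> sG G0; apply/cvgrPdist_lt => eps eps0.
have e2 : 0 < eps / 2 by rewrite divr_gt0.
have cF := @cvg_sum_fiber_dot G sG (fun x y Dy => G0 x y (or_intror Dy)).
have [J _ /(_ J (leqnn J)) /= HJ] := (cvgrPdist_lt _ _).1 cF _ e2.
have cJ : (\sum_(j < J) \sum_(i < n) pair_coef G i j ^+ 2) @[n --> \oo] -->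
    \sum_(j < J) dot mu (fiber_dot G (e j)) (fiber_dot G (e j)).
  apply: cvg_big => [|j _]; first exact: add_continuous.
  under eq_cvg do under eq_bigr do rewrite /pair_coef dot_fiber_dot//.
  apply: parseval => //; first exact: sqint_fiber_dot.
  apply: ce; first exact: sqint_fiber_dot.
  move=> x Dx; rewrite /fiber_dot /dot /Rintegral integral0_eq// => y _.
  by rewrite G0 ?mul0r//; left.
have /cvgrPdist_lt/(_ _ e2) HN := cJ; near=> n.
rewrite ger0_norm ?subr_ge0 ?bessel_tensor//.
have Jn : (J <= n)%N by near: n; exact: nbhs_infty_ge.
have : \sum_(j < J) \sum_(i < n) pair_coef G i j ^+ 2 <=
    \sum_(i < n) \sum_(j < n) pair_coef G i j ^+ 2.
  rewrite [leRHS]exchange_big/=.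
  pose h j := \sum_(i < n) pair_coef G i j ^+ 2.
  rewrite -!(big_mkord xpredT h) [leRHS](big_cat_nat (leq0n J) Jn)//= lerDl.
  by apply: sumr_ge0 => j _; apply: sumr_ge0 => i _; exact: sqr_ge0.
have : `|\sum_(j < J) dot mu (fiber_dot G (e j)) (fiber_dot G (e j)) -
    \sum_(j < J) \sum_(i < n) pair_coef G i j ^+ 2| < eps / 2.
  by near: n.
move: HJ; rewrite !ltr_norml => /andP[_ ?] /andP[_ ?] ?; lra.
Unshelve. all: by end_near. Qed.

End Parseval2.
End TensorProduct.

(** * Exchanging the two variables *)

Section Exchange.
Set Implicit Arguments.
Unset Strict Implicit.
Context {d : measure_display} {T : measurableType d} {R : realType}.
Variable mu : {sigma_finite_measure set T -> \bar R}.
Local Notation mu2 := (mu \x mu)%E.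
Implicit Types G H : T * T -> R.

(** Tonelli's theorem read in both orders. *)
Lemma ge0_integral_swap (f : T * T -> \bar R) : measurable_fun setT f ->
  (forall z, 0 <= f z)%E ->
  (\int[mu2]_z f (z.2, z.1) = \int[mu2]_z f z)%E.
Proof.
move=> mf f0; rewrite fubini_tonelli2//; last first.
  exact: (measurableT_comp mf (@measurable_swap _ _ T T)).
by rewrite fubini_tonelli1.
Qed.

Lemma integral_swap (f : T * T -> \bar R) : measurable_fun setT f ->
  (\int[mu2]_z f (z.2, z.1) = \int[mu2]_z f z)%E.
Proof.
move=> mf; rewrite integralE [RHS]integralE; congr (_ - _)%E.
- rewrite -(@ge0_integral_swap (f^\+)%E)//; last exact: measurable_funepos.
  by apply: eq_integral => z _; rewrite !funeposE.
- rewrite -(@ge0_integral_swap (f^\-)%E)//; last exact: measurable_funeneg.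
  by apply: eq_integral => z _; rewrite !funenegE.
Qed.

Lemma sqint_swap G : sqint mu2 G -> sqint mu2 (fun z => G (z.2, z.1)).
Proof.
move=> [mG iG].
have mG' : measurable_fun setT (fun z => G (z.2, z.1)).
  exact: (measurableT_comp mG (@measurable_swap _ _ T T)).
split => //.
apply/integrableP; split.
  by apply/measurable_EFinP; exact: measurable_funX.
have := integrable_lty measurableT iG.
rewrite -(integral_swap (measurable_int mu2 iG)) => H.
by under eq_integral do rewrite gee0_abs ?lee_fin ?sqr_ge0//.
Qed.

Lemma dot_swap G H : sqint mu2 G -> sqint mu2 H ->
  dot mu2 (fun z => G (z.2, z.1)) (fun z => H (z.2, z.1)) = dot mu2 G H.
Proof.
move=> sG sH; rewrite /dot /Rintegral.
by rewrite -(integral_swap (measurable_int mu2 (sqintM sG sH))).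
Qed.

(** The measure of a null set is the integral of its indicator, so the invariance
    of the integral shows that its mirror image is null too. *)
Lemma ae_swap (Q : T * T -> Prop) : {ae mu2, forall z, Q z} ->
  {ae mu2, forall z, Q (z.2, z.1)}.
Proof.
move=> [N [mN N0 QN]]; exists [set z | N (z.2, z.1)]; split.
- by rewrite -[X in measurable X]setTI; exact: measurable_swap.
- have mS : measurable [set z : T * T | N (z.2, z.1)].
    by rewrite -[X in measurable X]setTI; exact: measurable_swap.
  rewrite -N0 -[LHS]mul1e -[RHS]mul1e.
  rewrite -[in LHS]integral_cst// -[in RHS]integral_cst//.
  rewrite integral_mkcond [RHS]integral_mkcond.
  rewrite -[RHS]integral_swap; last first.
    by apply/(measurable_restrictT _ mN); exact: measurable_cst.
  by apply: eq_integral => z _; rewrite !patchE; congr (if _ then _ else _).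
- by move=> z /= nQ; exact: QN.
Qed.

Lemma ae_fst (Q : T -> Prop) : {ae mu, forall x, Q x} ->
  {ae mu2, forall z : T * T, Q z.1}.
Proof.
move=> [N [mN N0 QN]]; exists (N `*` setT); split.
- exact: measurableX.
- rewrite product_measure1E//; rewrite [X in (X * _)%E](_ : _ = 0%E) ?mul0e//.
- by move=> z /= nQ; split => //; exact: QN.
Qed.

Lemma ae_snd (Q : T -> Prop) : {ae mu, forall x, Q x} ->
  {ae mu2, forall z : T * T, Q z.2}.
Proof. by move=> /ae_fst/ae_swap. Qed.

End Exchange.

Section NullNorm.
Set Implicit Arguments.
Unset Strict Implicit.
Context {d : measure_display} {T : measurableType d} {R : realType}.
Variable mu : {measure set T -> \bar R}.

Lemma ae_imp (P Q : T -> Prop) : (forall x, P x -> Q x) ->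
  {ae mu, forall x, P x} -> {ae mu, forall x, Q x}.
Proof. by move=> PQ; apply: filterS. Qed.

Lemma ae_imp2 (P Q S : T -> Prop) : (forall x, P x -> Q x -> S x) ->
  {ae mu, forall x, P x} -> {ae mu, forall x, Q x} -> {ae mu, forall x, S x}.
Proof. by move=> PQS; apply: filterS2. Qed.

Lemma eq_ae_dot (u v : T -> R) : measurable_fun setT u ->
  measurable_fun setT v -> {ae mu, forall x, u x = v x} ->
  dot mu u u = dot mu v v.
Proof.
move=> mu_ mv uv; congr fine; apply: ae_eq_integral => //.
- by apply/measurable_EFinP; exact: measurable_funM.
- by apply/measurable_EFinP; exact: measurable_funM.
- by apply: ae_imp uv => x -> _.
Qed.

Lemma dot_eq0 (u : T -> R) : sqint mu u -> dot mu u u = 0 ->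
  {ae mu, forall x, u x = 0}.
Proof.
move=> su u0.
have := EFin_dot su su; rewrite u0 => /esym H.
have mu2 : measurable_fun setT (fun x => (u x * u x)%:E).
  exact: measurable_int (sqintM su su).
have : (\int[mu]_x `|(u x * u x)%:E| = 0%:E)%E.
  rewrite -H; apply: eq_integral => x _.
  by rewrite gee0_abs// lee_fin -expr2 sqr_ge0.
move/(ae_eq_integral_abs _ measurableT mu2).1.
apply: filterS => x /(_ I)/= [] /eqP; rewrite mulf_eq0 orbb.
exact/eqP.
Qed.

(** The parallelogram law without its nonnegative term [dot (u + v) (u + v)]. *)
Lemma dot_le_parallelogram (u v : T -> R) : sqint mu u -> sqint mu v ->
  dot mu (fun x => u x - v x) (fun x => u x - v x) <=
  2 * dot mu u u + 2 * dot mu v v.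
Proof.
move=> su sv.
have sB := sqintB su sv; have sD := sqintD su sv.
have := dot_ge0 mu (fun x => u x + v x).
rewrite dotBl// (dotC mu u) (dotC mu v (fun=> _)) !dotBl//.
rewrite dotDl// (dotC mu u (fun=> _)) (dotC mu v (fun=> _)) !dotDl//.
rewrite (dotC mu v u); lra.
Qed.

End NullNorm.

(** * Removing the weight *)

Section Weights.
Set Implicit Arguments.
Unset Strict Implicit.
Context {R : realType}.
Variables (I : interval R) (w : R -> R).
Hypothesis hw : is_weight I w.
Local Notation leb := (@lebesgue_measure R).
Local Notation leb2 := (@lebesgue_measure R \x @lebesgue_measure R)%E.
Implicit Types (u v : R -> R) (F G : R * R -> R).

(** Multiplication by this function embeds the weighted spaces isometrically into
    the unweighted ones, with the interval absorbed into the integrand. *)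
Definition root_weight (x : R) : R := if x \in I then Num.sqrt (w x) else 0.

Definition weigh u (x : R) : R := u x * root_weight x.

Definition weigh2 F (z : R * R) : R :=
  F z * (root_weight z.1 * root_weight z.2).

Lemma weight_ge0 x : x \in I -> 0 <= w x.
Proof. by case: hw => + _ _; apply. Qed.

Lemma measurable_weight : measurable_fun [set` I] w.
Proof.
case: hw => _ /(_ 0%N) /(measurable_int leb) mw _.
apply/measurable_EFinP; apply: eq_measurable_fun mw => x _ /=.
by rewrite expr0 mul1r.
Qed.

Lemma root_weight_restrict :
  root_weight = (fun x => Num.sqrt (w x)) \_ [set` I].
Proof. by apply/funext => x; rewrite patchE /root_weight mem_setE. Qed.

Lemma measurable_root_weight : measurable_fun setT root_weight.
Proof.
rewrite root_weight_restrict; apply/(measurable_restrictT _ (measurable_itv I)).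
have msqrt : measurable_fun setT (@Num.sqrt R).
  by apply: continuous_measurable_fun; exact: sqrt_continuous.
exact: (measurableT_comp msqrt measurable_weight).
Qed.

Lemma sqr_root_weight x : x \in I -> root_weight x ^+ 2 = w x.
Proof. by move=> xI; rewrite /root_weight xI sqr_sqrtr// weight_ge0. Qed.

Lemma root_weight0 x : x \notin I -> root_weight x = 0.
Proof. by rewrite /root_weight => /negbTE ->. Qed.

(** The definiteness of the weight, applied to the indicator of its zero set. *)
Lemma ae_root_weight_neq0 : {ae leb, forall x, x \in I -> root_weight x != 0}.
Proof.
case: hw => _ _ /(_ (fun x => (w x == 0)%:R)) h.
apply: ae_imp (h _ _ _) => [x /[swap] xI /(_ xI) /eqP| |x _|].
- rewrite pnatr_eq0 eqb0; apply: contra => /eqP r0.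
  by rewrite -(sqr_root_weight xI) r0 expr0n.
- have mb : measurable_fun setT (fun b : bool => b%:R : R) by [].
  have mw0 : measurable_fun [set` I] (fun x => w x == 0).
    by apply: measurable_fun_eqr => //; exact: measurable_weight.
  exact: (measurableT_comp mb mw0).
- exact: ler0n.
- apply: integral0_eq => x _; congr EFin.
  by case: eqP => [->|_]; rewrite ?mulr0 ?mul0r.
Qed.

Lemma ae_root_weight2_neq0 :
  {ae leb2, forall z : R * R, z.1 \in I -> z.2 \in I ->
  root_weight z.1 * root_weight z.2 != 0}.
Proof.
have h1 := ae_fst (mu := leb) ae_root_weight_neq0.
have h2 := ae_snd (mu := leb) ae_root_weight_neq0.
apply: ae_imp2 h1 h2 => z z1 z2 i1 i2.
by rewrite mulf_neq0 ?z1 ?z2.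
Qed.

Lemma ip_weigh u v : ip I w u v = dot leb (weigh u) (weigh v).
Proof.
rewrite /ip /dot Rintegral_mkcond; apply: eq_Rintegral => x _.
rewrite patchE mem_setE /weigh; case: ifPn => xI.
  by rewrite -(sqr_root_weight xI); ring.
by rewrite root_weight0// !mulr0.
Qed.

Lemma mem_square_set z : (z \in square_set I) = (z.1 \in I) && (z.2 \in I).
Proof. by rewrite /square_set in_setX !mem_setE. Qed.

Lemma measurable_square_set : measurable (square_set I).
Proof. exact: measurableX. Qed.

Lemma ip2_weigh F G : ip2 I w F G = dot leb2 (weigh2 F) (weigh2 G).
Proof.
rewrite /ip2 /dot Rintegral_mkcond; apply: eq_Rintegral => z _.
rewrite patchE mem_square_set /weigh2; case: ifPn => [/andP[z1 z2]|].
  by rewrite -(sqr_root_weight z1) -(sqr_root_weight z2); ring.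
by rewrite negb_and => /orP[] /root_weight0 ->; rewrite !(mulr0, mul0r).
Qed.

Lemma measurable_weigh u : measurable_fun [set` I] u ->
  measurable_fun setT (weigh u).
Proof.
move=> mu; rewrite (_ : weigh u = (u \_ [set` I]) \* root_weight).
  apply: measurable_funM; last exact: measurable_root_weight.
  by apply/(measurable_restrictT _ (measurable_itv I)).
apply/funext => x; rewrite /weigh /= patchE mem_setE.
by case: ifPn => // /root_weight0 ->; rewrite !mulr0.
Qed.

Lemma sqint_weigh u : inL2 I w u -> sqint leb (weigh u).
Proof.
move=> [mu iu]; split; first exact: measurable_weigh.
rewrite (_ : (fun x => _) = (fun x => (u x ^+ 2 * w x)%:E) \_ [set` I]).
  apply: (iffLR (@integrable_mkcond _ _ _ leb [set` I] _ _)) iu.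
  exact: measurable_itv.
apply/funext => x; rewrite patchE mem_setE /weigh; case: ifPn => xI.
  by rewrite exprMn sqr_root_weight.
by rewrite root_weight0// mulr0 expr0n.
Qed.

Lemma sqint_weigh2 F : inL2_2 I w F -> sqint leb2 (weigh2 F).
Proof.
move=> [mF iF]; split.
  rewrite (_ : weigh2 F =
    (F \_ (square_set I)) \* (tensor root_weight root_weight)).
    apply: measurable_funM; last first.
      by apply: measurable_tensor; exact: measurable_root_weight.
    by apply/(measurable_restrictT _ measurable_square_set).
  apply/funext => z; rewrite /weigh2 /= patchE mem_square_set /tensor.
  case: ifPn => //; rewrite negb_and => /orP[] /root_weight0 ->;
  by rewrite !(mulr0, mul0r).
rewrite (_ : (fun z => _) =
    (fun z => (F z ^+ 2 * (w z.1 * w z.2))%:E) \_ (square_set I)).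
  apply: (iffLR (@integrable_mkcond _ _ _ leb2 (square_set I) _ _)) iF.
  exact: measurable_square_set.
apply/funext => z; rewrite patchE mem_square_set /weigh2.
case: ifPn => [/andP[z1 z2]|].
  by rewrite !exprMn !sqr_root_weight.
rewrite negb_and => /orP[] /root_weight0 ->;
by rewrite !(mulr0, mul0r) expr0n.
Qed.

Lemma normL2_lt u eps : 0 < eps ->
  normL2 I w u < Num.sqrt eps -> dot leb (weigh u) (weigh u) < eps.
Proof. by move=> e0; rewrite /normL2 ltr_sqrt// ip_weigh. Qed.

Lemma sqr_normL2_2 F : normL2_2 I w F ^+ 2 = dot leb2 (weigh2 F) (weigh2 F).
Proof. by rewrite /normL2_2 ip2_weigh sqr_sqrtr// dot_ge0. Qed.

End Weights.

(** * The orthonormal polynomials *)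

Section Polynomials.
Set Implicit Arguments.
Unset Strict Implicit.
Context {R : realType}.
Variables (I : interval R) (w : R -> R) (P : nat -> {poly R}).
Hypothesis hw : is_weight I w.
Hypothesis hP : orthonormal_polys I w P.
Local Notation leb := (@lebesgue_measure R).
Local Notation leb2 := (@lebesgue_measure R \x @lebesgue_measure R)%E.

Definition weighed_poly i : R -> R := weigh I w (horner (P i)).
Local Notation e := weighed_poly.

Lemma measurable_horner (D : set R) (p : {poly R}) :
  measurable_fun D (horner p).
Proof.
apply: measurable_funTS; apply: continuous_measurable_fun.
exact: continuous_horner.
Qed.

(** The integral of [P_i ^ 2 * w] is nonnegative and its real part is 1, which
    excludes the value [+oo]. *)
Lemma inL2_poly i : inL2 I w (horner (P i)).
Proof.
split; first exact: measurable_horner.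
apply/integrableP; split.
  apply/measurable_EFinP; apply: measurable_funM; last first.
    exact: (measurable_weight hw).
  by apply: measurable_funX; exact: measurable_horner.
have Pw0 x : x \in I -> 0 <= (P i).[x] * (P i).[x] * w x.
  by move=> xI; rewrite mulr_ge0 ?(weight_ge0 hw)// -expr2 sqr_ge0.
have -> : (\int[leb]_(x in [set` I]) `|((P i).[x] ^+ 2 * w x)%:E| =
    \int[leb]_(x in [set` I]) ((P i).[x] * (P i).[x] * w x)%:E)%E.
  by apply: eq_integral => x /set_mem xI; rewrite expr2 gee0_abs// lee_fin Pw0.
have := hP.2 i i; rewrite eqxx /ip /Rintegral.
set J := (\int[_]_(x in _) _)%E; rewrite -[LHS]/(fine J).
have : (0 <= J)%E.
  by apply: integral_ge0 => x xI; rewrite lee_fin Pw0.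
case: J => [r _ _|_ /esym/eqP|//]; first exact: ltry.
by rewrite oner_eq0.
Qed.

Lemma sqint_weighed_poly i : sqint leb (e i).
Proof. by apply: sqint_weigh => //; exact: inL2_poly. Qed.

Lemma orthonormal_weighed_poly i j : dot leb (e i) (e j) = (i == j)%:R.
Proof. by rewrite -(ip_weigh hw) hP.2. Qed.

(** A square-integrable [u] that vanishes off [I] is almost everywhere the image
    under [weigh] of [v = u / sqrt w], to which completeness in the weighted
    space applies. *)
Lemma complete_weighed_poly : complete_in_L2 I w P ->
  forall u, sqint leb u -> (forall x, ~ [set` I] x -> u x = 0) ->
  forall eps, 0 < eps -> exists (n : nat) (c : nat -> R),
    dot leb (fun x => u x - \sum_(i < n) c i * e i x)
            (fun x => u x - \sum_(i < n) c i * e i x) < eps.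
Proof.
move=> hc u su u0 eps eps0.
(* The real power is [1 / sqrt (w x)]; where [w] vanishes its value is 0. *)
pose v x := u x * w x `^ (- 2^-1).
have vE x : x \in I -> v x ^+ 2 * w x <= u x ^+ 2.
  move=> xI; have w0 := weight_ge0 hw xI.
  rewrite /v powRN powR12_sqrt// exprMn exprVn sqr_sqrtr// -mulrA.
  have [->|wn0] := eqVneq (w x) 0; first by rewrite !mulr0 sqr_ge0.
  by rewrite mulVf// mulr1.
have [mu iu] := su.
have Lv : inL2 I w v.
  have mv : measurable_fun [set` I] v.
    apply: measurable_funM; first exact: measurable_funTS.
    have mpow := @measurable_powR R (- 2^-1).
    exact: (measurableT_comp mpow (measurable_weight hw)).
  split=> //.
  have iuI : leb.-integrable [set` I] (fun x => (u x ^+ 2)%:E).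
    by apply: integrableS iu => //; exact: measurable_itv.
  apply: le_integrable iuI; first exact: measurable_itv.
    apply/measurable_EFinP; apply: measurable_funM; last first.
      exact: (measurable_weight hw).
    exact: measurable_funX.
  move=> x xI; rewrite !gee0_abs ?lee_fin ?sqr_ge0 ?vE//.
  by rewrite mulr_ge0 ?sqr_ge0 ?(weight_ge0 hw).
have s0 : 0 < Num.sqrt eps by rewrite sqrtr_gt0.
have [n [c /(normL2_lt hw eps0) H]] := hc v Lv _ s0.
exists n, c; apply: le_lt_trans H; rewrite le_eqVlt; apply/orP; left; apply/eqP.
have Svc : sqint leb (fun x => \sum_(i < n) c i * e i x).
  by apply: sqint_sum => i; apply: sqintZ; exact: sqint_weighed_poly.
have WE : weigh I w (fun x => v x - \sum_(i < n) c i * (P i).[x]) =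
    (fun x => weigh I w v x - \sum_(i < n) c i * e i x).
  apply/funext => x; rewrite /weigh mulrBl mulr_suml; congr (_ - _).
  by apply: eq_bigr => i _; rewrite mulrA.
have sv : sqint leb (weigh I w v) by exact: sqint_weigh.
apply: eq_ae_dot.
- by case: (sqintB su Svc).
- by rewrite WE; case: (sqintB sv Svc).
apply: ae_imp (ae_root_weight_neq0 hw) => x rx.
rewrite WE; congr (_ - _); rewrite /weigh.
have [xI|xI] := boolP (x \in I); last first.
  by rewrite root_weight0// mulr0 u0//; exact/negP.
have := rx xI; rewrite /v /root_weight xI => rx0.
by rewrite powRN powR12_sqrt ?(weight_ge0 hw)// mulfVK.
Qed.

Lemma poly0_const : exists2 p : R, p != 0 & forall x, (P 0%N).[x] = p.
Proof.
have /eqP/size_poly1P [p p0 ->] := hP.1 0%N.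
by exists p => // x; rewrite hornerC.
Qed.

(** [P_1] has degree 1, hence [x = k + P_1(x) / a] with [a] its leading
    coefficient; pairing with [P_1], which is orthogonal to constants, identifies
    [1 / a] with [<x, P_1>]. *)
Lemma id_affine_poly1 : exists k, forall x,
  x = k + ip I w (fun x => x) (fun x => (P 1%N).[x]) * (P 1%N).[x].
Proof.
have [p p0 PE] := poly0_const.
have sP1 := hP.1 1%N.
set a := (P 1%N)`_1; set c := (P 1%N)`_0.
have a0 : a != 0.
  have := lead_coef_eq0 (P 1%N); rewrite /lead_coef sP1 /= -size_poly_eq0 sP1.
  by rewrite /a => ->.
have P1E x : (P 1%N).[x] = c + a * x.
  by rewrite horner_coef sP1 !big_ord_recl big_ord0/= addr0 expr0 mulr1 expr1.
have idE x : x = - (c / a) + a^-1 * (P 1%N).[x].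
  by rewrite P1E; field.
suff <- : a^-1 = ip I w (fun x => x) (fun x => (P 1%N).[x]).
  by exists (- (c / a)).
rewrite (ip_weigh hw) (_ : weigh I w _ =
  fun x => - (c / a) / p * e 0%N x + a^-1 * e 1%N x).
  have se := sqint_weighed_poly.
  have s0 := sqintZ (- (c / a) / p) (se 0%N).
  have s1 := sqintZ a^-1 (se 1%N).
  by rewrite (dotDl s0 s1 (se 1%N)) (dotZl _ (se 0%N) (se 1%N))
    (dotZl _ (se 1%N) (se 1%N)) !orthonormal_weighed_poly mulr0 add0r mulr1.
apply/funext => x; rewrite /e /weigh PE {1}(idE x).
by field; apply/andP.
Qed.

End Polynomials.

(** * Symplecticity as an antisymmetry of the kernel *)

Section Expansion.
Set Implicit Arguments.
Unset Strict Implicit.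
Context {R : realType}.
Variables (I : interval R) (w : R -> R) (P : nat -> {poly R}).
Hypothesis hw : is_weight I w.
Hypothesis hP : orthonormal_polys I w P.
Local Notation leb := (@lebesgue_measure R).
Local Notation leb2 := (@lebesgue_measure R \x @lebesgue_measure R)%E.
Local Notation e := (weighed_poly I w P).
Local Notation b := (ip I w (fun x => x) (fun x => (P 1%N).[x])).

Definition swap_diff_is_sub (F : R * R -> R) : Prop :=
  {ae leb2, forall z : R * R, z.1 \in I -> z.2 \in I ->
    F z - F (z.2, z.1) = z.1 - z.2}.

(** Once [Bbar] is replaced, the two sides of the exchange identity differ from
    those of the kernel identity by the nonzero factor [B_tau * B_sigma]. *)
Lemma antisym_kernelP (m : csRKN_coeffs R) :
  (forall tau, tau \in I -> cs_C m tau = tau) ->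
  (forall sigma, sigma \in I -> cs_B m sigma != 0) ->
  symplectic_condition I m <->
  (forall tau, tau \in I -> cs_Bbar m tau = cs_B m tau * (1 - tau)) /\
  swap_diff_is_sub (fun z => cs_Abar m z.1 z.2 / cs_B m z.2).
Proof.
move=> hC hB; rewrite /symplectic_condition /swap_diff_is_sub.
have BC : (forall tau, tau \in I ->
      cs_Bbar m tau = cs_B m tau * (1 - cs_C m tau))
    <-> (forall tau, tau \in I -> cs_Bbar m tau = cs_B m tau * (1 - tau)).
  by split=> h tau tI; rewrite h// hC.
split=> -[]; [move=> /(iffLR BC) hb h | move=> hb h]; split.
- exact: hb.
- apply: ae_imp h => z h z1 z2; have /= := h z1 z2; rewrite !hb//.
  have B1 := hB _ z1; have B2 := hB _ z2 => H.
  apply: (mulfI (mulf_neq0 B1 B2)); apply/eqP; rewrite -subr_eq0; apply/eqP.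
  transitivity (cs_B m z.2 * (cs_B m z.1 * (1 - z.1) - cs_Abar m z.2 z.1) -
    cs_B m z.1 * (cs_B m z.2 * (1 - z.2) - cs_Abar m z.1 z.2)).
    by field; apply/andP.
  by rewrite H subrr.
- exact: (iffRL BC).
- apply: ae_imp h => z h z1 z2; have /= := h z1 z2; rewrite !hb//.
  have B1 := hB _ z1; have B2 := hB _ z2 => H.
  apply/eqP; rewrite -subr_eq0; apply/eqP.
  transitivity (cs_B m z.1 * cs_B m z.2 * ((z.1 - z.2) -
    (cs_Abar m z.1 z.2 / cs_B m z.2 - cs_Abar m z.2 z.1 / cs_B m z.1))).
    by field; apply/andP.
  by rewrite H subrr mulr0.
Qed.

(** The symmetric coefficients cancel in the difference, and what is left is
    [b * (P_1(tau) - P_1(sigma))]. *)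
Lemma expansion_partial_swap (alpha : nat -> nat -> R) n z :
  alpha 0%N 1%N - alpha 1%N 0%N = - b ->
  (forall i j, (1 < i + j)%N -> alpha i j = alpha j i) ->
  expansion_partial P alpha n z - expansion_partial P alpha n (z.2, z.1) =
  z.1 - z.2.
Proof.
move=> h01 sym; rewrite /expansion_partial /=.
have [k idE] := id_affine_poly1 hw hP.
have -> : \sum_(i < n) \sum_(j < n | (1 < i + j)%N)
      alpha i j * ((P i).[z.2] * (P j).[z.1]) =
    \sum_(i < n) \sum_(j < n | (1 < i + j)%N)
      alpha i j * ((P i).[z.1] * (P j).[z.2]).
  rewrite (exchange_big_dep xpredT)//=; apply: eq_bigr => i _.
  rewrite (eq_bigl (fun j : 'I_n => (1 < i + j)%N)); last first.
    by move=> j; rewrite addnC.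
  by apply: eq_bigr => j ij; rewrite (sym i j)// [X in _ * X]mulrC.
rewrite [X in _ = X - _]idE [X in _ = _ - X]idE.
have -> : b = alpha 1%N 0%N - alpha 0%N 1%N by rewrite -opprB h01 opprK.
ring.
Qed.

Lemma sum_low_high n (g : nat -> nat -> R) :
  \sum_(i < n.+2) \sum_(j < n.+2) g i j =
  g 0%N 0%N + g 0%N 1%N + g 1%N 0%N +
  \sum_(i < n.+2) \sum_(j < n.+2 | (1 < i + j)%N) g i j.
Proof.
under eq_bigr => i _ do rewrite (bigID (fun j : 'I_n.+2 => 1 < i + j)%N)/=.
rewrite big_split/= addrC; congr (_ + _).
rewrite big_ord_recl big_ord_recl/= [X in _ + (_ + X)]big1 ?addr0; last first.
  by move=> i _; rewrite big_pred0// => j; rewrite !lift0.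
have g0 : \sum_(j < n.+2 | ~~ (1 < 0 + j)%N) g 0%N j = g 0%N 0%N + g 0%N 1%N.
  by rewrite big_mkcond !big_ord_recl/= big1 ?addr0.
have g1 : \sum_(j < n.+2 | ~~ (1 < 1 + j)%N) g 1%N j = g 1%N 0%N.
  by rewrite big_mkcond big_ord_recl/= big1 ?addr0.
by rewrite [X in X + _]g0 [X in _ + X]g1.
Qed.

Lemma sqint_weigh2_partial alpha n :
  sqint leb2 (weigh2 I w (expansion_partial P alpha n)).
Proof.
have [p p0 PE] := poly0_const hP.
have se i j : sqint leb2 (tensor (e i) (e j)).
  by apply: sqint_tensor; exact: sqint_weighed_poly.
rewrite (_ : weigh2 I w _ = fun z =>
  (alpha 0%N 0%N / p ^+ 2 * tensor (e 0%N) (e 0%N) z +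
   alpha 0%N 1%N / p * tensor (e 0%N) (e 1%N) z +
   alpha 1%N 0%N / p * tensor (e 1%N) (e 0%N) z) +
  \sum_(i < n) \sum_(j < n | (1 < i + j)%N) alpha i j * tensor (e i) (e j) z).
  apply: sqintD; last first.
    by apply: sqint_sum => i; apply: sqint_sum => j; exact: sqintZ.
  by apply: sqintD; [apply: sqintD|]; exact: sqintZ.
apply/funext => z; rewrite /weigh2 /expansion_partial mulrDl; congr (_ + _).
  by rewrite /tensor /weighed_poly /weigh !PE; field.
rewrite mulr_suml; apply: eq_bigr => i _; rewrite mulr_suml.
apply: eq_bigr => j _; rewrite /tensor /weighed_poly /weigh; ring.
Qed.

(** By [expansion_partial_swap], the defect of [S] equals [H - H'] where
    [H = S - S_n] and [H'] is its transpose; [n] is arbitrary, so the norm of the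
    defect is 0. *)
Lemma antisym_of_expansion (alpha : nat -> nat -> R) (S : R * R -> R) :
  alpha 0%N 1%N - alpha 1%N 0%N = - b ->
  (forall i j, (1 < i + j)%N -> alpha i j = alpha j i) ->
  expansion_sum I w P alpha S -> swap_diff_is_sub S.
Proof.
move=> h01 sym [LS cS].
pose D z := S z - S (z.2, z.1) - (z.1 - z.2).
pose H n := weigh2 I w (fun z => S z - expansion_partial P alpha n z).
have HE n : H n = fun z =>
    weigh2 I w S z - weigh2 I w (expansion_partial P alpha n) z.
  by apply/funext => z; rewrite /H /weigh2 mulrBl.
have sH n : sqint leb2 (H n).
  rewrite HE; apply: sqintB; first exact: sqint_weigh2.
  exact: sqint_weigh2_partial.
have DH n : weigh2 I w D = fun z => H n z - H n (z.2, z.1).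
  apply/funext => z; rewrite /H /D /weigh2/=.
  by rewrite -(expansion_partial_swap n z h01 sym); ring.
have sD : sqint leb2 (weigh2 I w D).
  by rewrite (DH 0%N); apply: sqintB => //; exact: sqint_swap.
have D0 : dot leb2 (weigh2 I w D) (weigh2 I w D) = 0.
  apply/eqP; rewrite eq_le dot_ge0 andbT.
  have bound n : dot leb2 (weigh2 I w D) (weigh2 I w D) <=
      4 * normL2_2 I w (fun z => S z - expansion_partial P alpha n z) ^+ 2.
    rewrite (sqr_normL2_2 hw) -/(H n) (DH n).
    apply: le_trans (dot_le_parallelogram (sH n) (sqint_swap (sH n))) _.
    by rewrite dot_swap// -mulrDl -natrD.
  have cv :
    (4 * normL2_2 I w (fun z => S z - expansion_partial P alpha n z) ^+ 2)
      @[n --> \oo] --> (4 * 0 ^+ 2 : R).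
    apply: cvgM; first exact: cvg_cst.
    by rewrite expr2; under eq_fun do rewrite expr2; exact: cvgM.
  rewrite expr0n mulr0 in cv.
  apply: (ler_cvg_to (cvg_cst _) cv).
  exact: nearW.
apply: ae_imp2 (dot_eq0 sD D0) (ae_root_weight2_neq0 hw) => z Dz rz z1 z2.
apply/eqP; rewrite -subr_eq0; apply/eqP; apply: (mulIf (rz z1 z2)).
by rewrite mul0r; exact: Dz.
Qed.

Lemma weigh2_antisym (F : R * R -> R) : swap_diff_is_sub F ->
  {ae leb2, forall z, weigh2 I w F z - weigh2 I w F (z.2, z.1) =
    weigh2 I w (fun z => z.1 - z.2) z}.
Proof.
apply: ae_imp => z Fz; rewrite /weigh2/= [X in _ - _ * X]mulrC -mulrBl.
have [z1|z1] := boolP (z.1 \in I); last by rewrite root_weight0// mul0r !mulr0.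
have [z2|z2] := boolP (z.2 \in I); last first.
  by rewrite (root_weight0 _ z2) mulr0 !mulr0.
by rewrite Fz.
Qed.

(** Transposing [F] transposes its coefficients, so their antisymmetric part is
    the coefficient of [tau - sigma], which is [b / p] times
    [P_1(tau) * P_0(sigma) - P_0(tau) * P_1(sigma)]. *)
Lemma pair_coef_antisym (F : R * R -> R) p i j : inL2_2 I w F ->
  swap_diff_is_sub F -> p != 0 -> (forall x, (P 0%N).[x] = p) ->
  let a := pair_coef leb e (weigh2 I w F) in
  a i j - a j i = b / p * ((i == 1%N)%:R * (j == 0%N)%:R -
                           (i == 0%N)%:R * (j == 1%N)%:R).
Proof.
move=> LF aF p0 PE /=.
have sF := sqint_weigh2 hw LF; have sF' := sqint_swap sF.
have se i' j' : sqint leb2 (tensor (e i') (e j')).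
  by apply: sqint_tensor; exact: sqint_weighed_poly.
have -> : pair_coef leb e (weigh2 I w F) j i =
    dot leb2 (fun z => weigh2 I w F (z.2, z.1)) (tensor (e i) (e j)).
  rewrite -(dot_swap sF' (se i j)); apply: eq_Rintegral => -[x y] _ /=.
  by rewrite /tensor/= [e i _ * _]mulrC.
have [k idE] := id_affine_poly1 hw hP.
have dE : weigh2 I w (fun z => z.1 - z.2) = fun z =>
    b / p * (tensor (e 1%N) (e 0%N) z - tensor (e 0%N) (e 1%N) z).
  apply/funext => z; rewrite /weigh2 /tensor /weighed_poly /weigh !PE.
  by rewrite {1}(idE z.1) {1}(idE z.2); field.
have s01 := sqintB (se 1%N 0%N) (se 0%N 1%N).
rewrite -(dotBl sF sF' (se i j)).
transitivity (dot leb2 (fun z => b / p * (tensor (e 1%N) (e 0%N) z -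
    tensor (e 0%N) (e 1%N) z)) (tensor (e i) (e j))).
  congr fine; apply: ae_eq_integral => //.
  - exact: (measurable_int leb2 (sqintM (sqintB sF sF') (se i j))).
  - exact: (measurable_int leb2 (sqintM (sqintZ _ s01) (se i j))).
  by apply: ae_imp (weigh2_antisym aF) => z zE _; rewrite zE dE.
have sw := sqint_weighed_poly hw hP.
rewrite dotZl// dotBl// !dot_tensor// !(orthonormal_weighed_poly hw hP).
by rewrite ![(_ == i)]eq_sym ![(_ == j)]eq_sym.
Qed.

Lemma expansion_of_antisym (F : R * R -> R) : complete_in_L2 I w P ->
  inL2_2 I w F -> swap_diff_is_sub F ->
  exists alpha : nat -> nat -> R,
    [/\ alpha 0%N 1%N - alpha 1%N 0%N = - b,
        forall i j : nat, (1 < i + j)%N -> alpha i j = alpha j i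
      & expansion_sum I w P alpha F].
Proof.
move=> hc LF aF; have [p p0 PE] := poly0_const hP.
pose a := pair_coef leb e (weigh2 I w F).
have aE i j : a i j - a j i = b / p * ((i == 1%N)%:R * (j == 0%N)%:R -
                           (i == 0%N)%:R * (j == 1%N)%:R).
  exact: (pair_coef_antisym i j LF aF p0 PE).
(* The expansion writes its terms of degree at most 1 without the factors
   [P_0]: two of them are missing at (0, 0), one at (0, 1) and at (1, 0), and
   none at higher indices, where the truncated exponent is 0. *)
exists (fun i j => a i j * p ^+ (2 - (i + j))); split.
- by rewrite /= !expr1 -mulrBl aE/=; field.
- move=> i j ij; rewrite (addnC j i); congr (_ * _).
  apply/eqP; rewrite -subr_eq0 aE; apply/eqP.
  by case: i j ij => [|[|i]] [|[|j]]//= _; ring.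
- split => //.
  have sF := sqint_weigh2 hw LF.
  have se := sqint_weighed_poly hw hP.
  have oe := orthonormal_weighed_poly hw hP.
  have := parseval_tensor se oe (complete_weighed_poly hw hP hc) sF.
  have F0 x y : ~ [set` I] x \/ ~ [set` I] y -> weigh2 I w F (x, y) = 0.
    by case=> /negP xI; rewrite /weigh2/= (root_weight0 _ xI) ?(mulr0, mul0r).
  move=> /(_ F0) cv.
  set f := (X in X @ _ --> _).
  have fE n : (2 <= n)%N -> f n = Num.sqrt
      (dot leb2 (weigh2 I w F) (weigh2 I w F) -
       \sum_(i < n) \sum_(j < n) a i j ^+ 2).
    case: n => [|[|n]]// _; rewrite /f /normL2_2 (ip2_weigh hw); congr Num.sqrt.
    rewrite -[RHS]addr0 -[X in _ = _ + X](_ : \sum_(i < n.+2) \sum_(j < n.+2)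
      (a i j - a i j) ^+ 2 = 0); last first.
      by rewrite big1// => i _; rewrite big1// => j _; rewrite subrr expr0n.
    rewrite -(dist_tensor se oe n.+2 a sF).
    have -> : weigh2 I w (fun z => F z -
        expansion_partial P (fun i j => a i j * p ^+ (2 - (i + j))) n.+2 z) =
      fun z => weigh2 I w F z -
        \sum_(i < n.+2) \sum_(j < n.+2) a i j * tensor (e i) (e j) z;
      last by [].
    apply/funext => z.
    rewrite (sum_low_high _ (fun i j => a i j * tensor (e i) (e j) z)).
    rewrite /weigh2 mulrBl; congr (_ - _).
    rewrite /expansion_partial mulrDl; congr (_ + _).
      rewrite /tensor /weighed_poly /weigh !PE/= expr1; ring.
    rewrite mulr_suml; apply: eq_bigr => i _; rewrite mulr_suml.
    apply: eq_bigr => j ij; rewrite (_ : 2 - (i + j) = 0)%N; last first.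
      by apply/eqP; rewrite subn_eq0.
    rewrite /tensor /weighed_poly /weigh; ring.
  have {}cv : Num.sqrt (dot leb2 (weigh2 I w F) (weigh2 I w F) -
      \sum_(i < n) \sum_(j < n) a i j ^+ 2) @[n --> \oo] --> (0 : R).
    rewrite -[X in _ --> X]sqrtr0; apply: continuous_cvg.
      exact: sqrt_continuous.
    rewrite -[X in _ --> X](subrr (dot leb2 (weigh2 I w F) (weigh2 I w F))).
    by apply: cvgB => //; exact: cvg_cst.
  apply: cvg_trans cv; apply: near_eq_cvg; near=> n.
  by apply/esym/fE; near: n; exact: nbhs_infty_ge.
Unshelve. all: by end_near. Qed.

End Expansion.

Theorem theorem4p4 (R : realType) (I : interval R) (w : R -> R)
    (P : nat -> {poly R}) (m : csRKN_coeffs R)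
    (hw : is_weight I w)
    (hP : orthonormal_polys I w P)
    (hPcomplete : complete_in_L2 I w P)
    (hC : forall tau, tau \in I -> cs_C m tau = tau)
    (hB : forall sigma, sigma \in I -> cs_B m sigma != 0)
    (hAB : inL2_2 I w (fun z => cs_Abar m z.1 z.2 / cs_B m z.2)) :
  symplectic_condition I m <-> has_expansion_form I w P m.
Proof.
rewrite (antisym_kernelP hC hB); split=> -[hb h]; split=> //.
  have [alpha [h01 sym hS]] := expansion_of_antisym hw hP hPcomplete hAB h.
  exists alpha; split=> //.
  exists (fun z => cs_Abar m z.1 z.2 / cs_B m z.2) => //.
  apply: aeW => z _ z2.
  by rewrite mulrC divfK// hB.
have [alpha [h01 sym [S hS AS]]] := h.
have aS := antisym_of_expansion hw hP h01 sym hS.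
have AS' := ae_swap (mu := @lebesgue_measure R) AS.
have AF : {ae (@lebesgue_measure R \x @lebesgue_measure R)%E, forall z : R * R,
    z.1 \in I -> z.2 \in I ->
    cs_Abar m z.1 z.2 / cs_B m z.2 = S z /\
    cs_Abar m z.2 z.1 / cs_B m z.1 = S (z.2, z.1)}.
  apply: ae_imp2 AS AS' => z h1 h2 z1 z2.
  by rewrite h1// h2//= ![cs_B m _ * _]mulrC !mulfK// hB.
apply: ae_imp2 AF aS => z h1 h2 z1 z2 /=.
by have [-> ->] := h1 z1 z2; exact: h2.
Qed.
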